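(* For all $n\ge1$ and all $f:\{0,1\}^n\to(0,\infty)$ with $\mathbb{E}[f]=1$ we have $$\frac1n\,\mathcal{E}(f,\ln f)\ge b_1\left(\frac1n\,\mathrm{Ent}(f)\right),$$ where $b_1:[0,\ln2)\to[0,\infty)$ is a convex increasing function given by $$b_1(\ln 2-h(y))=\left(\tfrac12-y\right)\ln\frac{1-y}{y},\qquad y\in(0,1/2].$$
   Context: All expectations and $\mathrm{Ent}$ are with respect to the uniform probability measure on $\{0,1\}^n$; $\mathrm{Ent}(g)=\mathbb{E}\left[g\ln\frac{g}{\mathbb{E}[g]}\right]$. The Dirichlet form on $\{0,1\}^n$ is $\mathcal{E}(f,g)=-\frac12\,\mathbb{E}[(\triangle f)\,g]$, with $\triangle f(x)=\sum_{y:\,y\sim x}(f(y)-f(x))$, where $x\sim y$ means that $x,y$ differ in precisely one coordinate. $h(x)=-x\ln x-(1-x)\ln(1-x)$ is the binary entropy function (natural logarithm). *)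

(* Defs.v *)
From mathcomp Require Import all_boot all_order all_algebra.
From mathcomp Require Import all_classical all_reals exp convex.

Set Implicit Arguments.
Unset Strict Implicit.
Unset Printing Implicit Defensive.

Import Order.TTheory GRing.Theory Num.Theory.

Local Open Scope classical_set_scope.
Local Open Scope ring_scope.

Definition cube (n : nat) : finType := {ffun 'I_n -> bool}.

Definition cube_adj (n : nat) (x y : cube n) : bool :=
  #|[pred i | x i != y i]| == 1%N.

Definition expect (R : realType) (n : nat) (g : cube n -> R) : R :=
  (\sum_x g x) / #|cube n|%:R.

Definition Ent (R : realType) (n : nat) (g : cube n -> R) : R :=
  expect (fun x => g x * ln (g x / expect g)).

Definition laplacian (R : realType) (n : nat) (f : cube n -> R) (x : cube n) :
    R :=
  \sum_(y | cube_adj x y) (f y - f x).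

Definition dirichlet (R : realType) (n : nat) (f g : cube n -> R) : R :=
  - (2^-1 * expect (fun x => laplacian f x * g x)).

Definition bin_entropy (R : realType) (x : R) : R :=
  - (x * ln x) - (1 - x) * ln (1 - x).

(* For t in [0, ln 2[, [b1_param t] is the parameter y in ]0, 1/2] such that
   ln 2 - h(y) = t; the default 1/2 is only used for t outside [0, ln 2[. *)
Definition b1_param (R : realType) (t : R) : R :=
  xget 2^-1 [set y | 0 < y <= 2^-1 /\ ln 2 - bin_entropy y = t].

Definition b1 (R : realType) (t : R) : R :=
  let y := b1_param t in (2^-1 - y) * ln ((1 - y) / y).

(* Main.v *)
Require Import Defs.
From mathcomp Require Import all_boot all_order all_algebra.
From mathcomp Require Import all_classical all_reals exp convex.
From mathcomp Require Import interval_inference topology normedtype derive realfun.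
From mathcomp Require Import ring lra.

Set Implicit Arguments.
Unset Strict Implicit.
Unset Printing Implicit Defensive.

Import Order.TTheory GRing.Theory Num.Theory.
Import numFieldNormedType.Exports.

Local Open Scope classical_set_scope.
Local Open Scope ring_scope.

(** Write [psi y = ln 2 - h(y)] ([deficit] below) and
    [B y = (1/2 - y) ln ((1 - y) / y)] ([energy] below), so that
    [b1 (psi y) = B y].

    On one edge of the cube the inequality is an equality.  If a positive
    function takes the values [a] and [b] on the edge, with mean [m], and [y] is
    the fraction of its mass at the smaller value, then the entropy on the edge
    is [m * psi y] and the Dirichlet form on the edge is [m * B y]
    ([pair_param]).  Both sides of the inequality on the cube are then compared
    with their sums over edges.

    The Dirichlet form is exactly the sum over the [n] directions of the average
    edge form ([dirichlet_flip]).  The entropy is at most the sum over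
    directions of the average edge entropy ([Ent_le_sum_edge_entropy]): average
    [f] over the coordinates one after the other, which goes from [f] to its
    expectation, and telescope [ln (f / E f)] along the way; each step costs at
    most the edge entropy of [f] in that direction, by Gibbs' inequality on
    edges ([expect_ln_ratio_le]).

    What joins the two is Jensen's inequality for [b1], used in the form of a
    supporting line of slope [c >= 0] at the point [Ent f / n] ([b1_support]).
    The edge weights [m] average to [E f = 1], so the line summed over all the
    edges bounds the Dirichlet form from below by [n * b1 (Ent f / n)] plus [c]
    times the nonnegative gap in the subadditivity of entropy.

    Supporting lines of [b1] exist because [dB / dpsi = 1 + k y] with
    [k y = (1/2 - y) / (y (1 - y) L)], where [L = ln ((1 - y) / y)] is [-psi'],
    and [k] decreases in [y] ([slope_nonincreasing]) while [psi] decreases as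
    well.  In terms of [L] the slope is [1 + sinh L / L].  Convexity of [b1]
    also follows from its supporting lines. *)

(** * The function [b1] and its supporting lines *)

Section one_variable.
Context {R : realType}.
Implicit Types (a b c s t x y z : R) (f df : R -> R).

Lemma MVT_derive f df a b : a < b ->
    (forall x, a <= x <= b -> is_derive x 1 f (df x)) ->
  exists2 c, a < c < b & f b - f a = df c * (b - a).
Proof.
move=> ab fdf.
have [||c] := @MVT R f df a b ab.
- by move=> x /[!in_itv]/= /andP[ax xb]; apply: fdf; rewrite !ltW.
- apply: derivable_within_continuous => x /[!in_itv]/= axb.
  by have [] := fdf _ axb.
- by rewrite in_itv /=; exists c.
Qed.

Lemma derive_le0_le f df a b : a <= b ->
    (forall x, a <= x <= b -> is_derive x 1 f (df x)) ->
    (forall x, a < x < b -> df x <= 0) ->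
  f b <= f a.
Proof.
rewrite le_eqVlt => /predU1P[->//|ab] fdf df0.
have [c acb e] := MVT_derive ab fdf.
by rewrite -subr_le0 e mulr_le0_ge0 ?df0// subr_ge0 ltW.
Qed.

Definition deficit y : R := ln 2 - bin_entropy y.

(** The difference of logarithms, and not the logarithm of the quotient, so that
    it can be differentiated term by term. *)
Definition log_odds y : R := ln (1 - y) - ln y.

Definition energy y : R := (2^-1 - y) * log_odds y.

Lemma log_oddsE y : 0 < y < 1 -> log_odds y = ln ((1 - y) / y).
Proof. by move=> /andP[y0 y1]; rewrite ln_div// posrE subr_gt0. Qed.

Lemma log_odds_half : log_odds 2^-1 = 0.
Proof. by rewrite /log_odds (_ : 1 - 2^-1 = 2^-1 :> R) ?subrr//; lra. Qed.

Lemma log_odds_lt a b : 0 < a -> a < b -> b < 1 -> log_odds b < log_odds a.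
Proof.
by move=> a0 ab b1; apply: ltrB; rewrite ltr_ln ?posrE; lra.
Qed.

Lemma log_odds_gt0 y : 0 < y < 2^-1 -> 0 < log_odds y.
Proof.
move=> /andP[y0 yh]; rewrite -log_odds_half; apply: log_odds_lt => //; lra.
Qed.

Lemma log_odds_ge0 y : 0 < y <= 2^-1 -> 0 <= log_odds y.
Proof.
move=> /andP[y0]; rewrite le_eqVlt => /predU1P[->|yh].
  by rewrite log_odds_half.
by rewrite ltW// log_odds_gt0// y0.
Qed.

Lemma is_derive_ln1B y : y < 1 ->
  is_derive y 1 (fun x : R => ln (1 - x)) (- (1 - y)^-1).
Proof.
move=> y1.
have h1 : is_derive (1 - y) 1 (@ln R) (1 - y)^-1.
  by apply: is_derive1_ln; rewrite subr_gt0.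
have h2 : is_derive y 1 (fun x : R => 1 - x) (- 1).
  by apply: is_derive_eq; rewrite /GRing.scale/=; ring.
have := @is_derive1_comp R (@ln R) (fun x => 1 - x) y _ _ h1 h2.
by move=> h; apply: is_derive_eq; rewrite mulrN1.
Qed.

Lemma is_derive_log_odds y : 0 < y < 1 ->
  is_derive y 1 log_odds (- (y * (1 - y))^-1).
Proof.
move=> /andP[y0 y1].
have h1 := is_derive_ln1B y1; have h2 := is_derive1_ln y0.
rewrite /log_odds; apply: is_derive_eq.
by field; lra.
Qed.

Lemma is_derive_deficit y : 0 < y < 1 -> is_derive y 1 deficit (- log_odds y).
Proof.
move=> /andP[y0 y1].
have h1 := is_derive_ln1B y1; have h2 := is_derive1_ln y0.
rewrite /deficit /bin_entropy.
apply: is_derive_eq; rewrite /log_odds /GRing.scale/=.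
by field; lra.
Qed.

Lemma is_derive_energy y : 0 < y < 1 ->
  is_derive y 1 energy (- log_odds y - (2^-1 - y) / (y * (1 - y))).
Proof.
move=> yb; have h1 := is_derive_log_odds yb.
rewrite /energy; apply: is_derive_eq; rewrite /GRing.scale/=.
by field; lra.
Qed.

(** The right-hand side is the tangent at [1/2], above which [log_odds] stays
    because it is convex on this interval; this is what makes the slope of the
    supporting lines monotone. *)
Lemma log_odds_ge y : 0 < y <= 2^-1 -> 2 - 4 * y <= log_odds y.
Proof.
move=> /andP[y0 yh].
have h := @derive_le0_le (fun x => log_odds x + 4 * x)
  (fun x => - (x * (1 - x))^-1 + 4) y 2^-1 yh.
suff : log_odds 2^-1 + 4 * 2^-1 <= log_odds y + 4 * y.
  by rewrite log_odds_half; lra.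
apply: h => x xb.
- have h : is_derive x 1 log_odds (- (x * (1 - x))^-1).
    by apply: is_derive_log_odds; lra.
  by apply: is_derive_eq; rewrite /GRing.scale/=; ring.
- have p : 0 < x * (1 - x) by rewrite mulr_gt0; lra.
  rewrite addrC subr_le0 -[leLHS]invrK lef_pV2 ?posrE ?invr_gt0//.
  nra.
Qed.

Lemma deficit_lt a b : 0 < a -> a < b -> b <= 2^-1 -> deficit b < deficit a.
Proof.
move=> a0 ab bh.
have [|c cab e] := @MVT_derive deficit (fun y => - log_odds y) a b ab.
  by move=> x xab; apply: is_derive_deficit; lra.
rewrite -subr_lt0 e mulNr oppr_lt0 mulr_gt0//; last by rewrite subr_gt0.
by apply: log_odds_gt0; lra.
Qed.

Lemma deficit_le a b : 0 < a -> a <= b -> b <= 2^-1 -> deficit b <= deficit a.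
Proof.
move=> a0; rewrite le_eqVlt => /predU1P[->//|ab bh].
by rewrite ltW// deficit_lt.
Qed.

Lemma deficit_inj : {in `]0, 2^-1] &, injective deficit}.
Proof.
move=> a b; rewrite !in_itv/= => /andP[a0 ah] /andP[b0 bh] e.
have [ab|ba|//] := ltgtP a b.
- by have := deficit_lt a0 ab bh; rewrite e ltxx.
- by have := deficit_lt b0 ba ah; rewrite e ltxx.
Qed.

Lemma deficit_half : deficit 2^-1 = 0.
Proof.
rewrite /deficit /bin_entropy (_ : 1 - 2^-1 = 2^-1 :> R); last by lra.
by rewrite lnV ?posrE//; lra.
Qed.

Lemma deficit_ge0 y : 0 < y <= 2^-1 -> 0 <= deficit y.
Proof. by move=> /andP[y0 yh]; rewrite -deficit_half deficit_le. Qed.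

Lemma bin_entropy_gt0 y : 0 < y <= 2^-1 -> 0 < bin_entropy y.
Proof.
move=> /andP[y0 yh].
have h1 : ln y < 0 by apply: ln_lt0; lra.
have h2 : ln (1 - y) < 0 by apply: ln_lt0; lra.
rewrite /bin_entropy.
have : y * ln y < 0 by rewrite pmulr_rlt0.
have : (1 - y) * ln (1 - y) < 0 by rewrite pmulr_rlt0; lra.
lra.
Qed.

Lemma deficit_lt_ln2 y : 0 < y <= 2^-1 -> deficit y < ln 2.
Proof. by move=> /bin_entropy_gt0 h; rewrite /deficit ltrBlDr ltrDl. Qed.

Lemma ln_le_sub1 x : 0 < x -> ln x <= x - 1.
Proof.
move=> x0; have h := @le_ln1Dx R (x - 1).
by rewrite (_ : x = 1 + (x - 1)) ?h; lra.
Qed.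

(** The limit [h(y) -> 0] at [y = 0] with an explicit rate: once [y] is written
    as a square, [ln x <= x - 1] suffices, because [- ln (z ^ 2) <= 2 / z]. *)
Lemma bin_entropy_sqr_le z : 0 < z < 1 -> bin_entropy (z ^+ 2) <= 3 * z.
Proof.
move=> /andP[z0 z1].
have z2 : z ^+ 2 < z by nra.
have h1 : - ln z <= z^-1 - 1 by rewrite -lnV ?posrE// ln_le_sub1// invr_gt0.
have h2 : - ln (1 - z ^+ 2) <= (1 - z ^+ 2)^-1 - 1.
  by rewrite -lnV ?posrE ?ln_le_sub1 ?invr_gt0//; lra.
have h3 : - (z ^+ 2 * ln (z ^+ 2)) <= 2 * z.
  rewrite lnXn// mulr2n.
  have : z ^+ 2 * (- ln z) <= z ^+ 2 * (z^-1 - 1).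
    by rewrite ler_pM2l// exprn_gt0.
  rewrite mulrBr mulr1 expr2 mulfK ?gt_eqF//; nra.
have h4 : - ((1 - z ^+ 2) * ln (1 - z ^+ 2)) <= z ^+ 2.
  have : (1 - z ^+ 2) * (- ln (1 - z ^+ 2)) <= (1 - z ^+ 2) * ((1 - z ^+ 2)^-1 - 1).
    by rewrite ler_pM2l//; lra.
  by rewrite mulrBr mulr1 divff; lra.
rewrite /bin_entropy; lra.
Qed.

(** Values arbitrarily close to [ln 2] are reached near [0], where the entropy is
    small, and the intermediate value theorem gives the others. *)
Lemma deficit_surj t : 0 <= t < ln 2 -> exists2 y, 0 < y <= 2^-1 & deficit y = t.
Proof.
move=> /andP[t0 t2].
(* [3 * z] is at most [ln 2 - t], hence [deficit (z ^+ 2) >= t]. *)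
pose z : R := Num.min 2^-1 ((ln 2 - t) / 3).
have z0 : 0 < z by rewrite /z lt_min; apply/andP; split; lra.
have [z1 z2] : z <= 2^-1 /\ z <= (ln 2 - t) / 3 by rewrite /z !ge_min !lexx orbT.
have zh : z ^+ 2 <= 2^-1 by nra.
have zz0 : 0 < z ^+ 2 by rewrite exprn_gt0.
have [||y] := @IVT R deficit (z ^+ 2) 2^-1 t zh.
- apply: derivable_within_continuous => x /[!in_itv]/= xb.
  by have [] := @is_derive_deficit x _; first lra.
- rewrite deficit_half ge_min t0 orbT/= le_max.
  have := @bin_entropy_sqr_le z.
  rewrite /deficit => h; apply/orP; left.
  suff: bin_entropy (z ^+ 2) <= 3 * z by lra.
  by apply: h; lra.
- rewrite in_itv/= => /andP[h1 h2] e; exists y => //.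
  by rewrite h2 (lt_le_trans zz0).
Qed.

(** The quotient is [sinh L / L] at [L = log_odds y], increasing in [L].
    In the variable [y], the sign of its derivative is that of
    [(1/2 - y) - (1/2 - y + y ^ 2) L], and [L >= 2 - 4 y] suffices because
    [1/2 - y + y ^ 2 >= 1/4]. *)
Lemma slope_nonincreasing a b : 0 < a -> a <= b -> b < 2^-1 ->
  (2^-1 - b) / (b * (1 - b) * log_odds b) <= (2^-1 - a) / (a * (1 - a) * log_odds a).
Proof.
move=> a0 ab bh.
pose D x := x * (1 - x) * log_odds x.
have D0 x : a <= x <= b -> 0 < D x.
  by move=> xab; rewrite /D !mulr_gt0 ?log_odds_gt0//; lra.
pose dD x := (1 - 2 * x) * log_odds x - 1.
apply: (@derive_le0_le (fun x => (2^-1 - x) / D x)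
  (fun x => - (D x + (2^-1 - x) * dD x) / D x ^+ 2) a b ab) => x xab.
- have x01 : 0 < x < 1 by lra.
  have hL := is_derive_log_odds x01.
  have hD : is_derive x 1 D (dD x).
    rewrite /D; apply: is_derive_eq; rewrite /GRing.scale/= /dD.
    by field; lra.
  have Dx0 : D x != 0 by rewrite gt_eqF ?D0.
  have hV := is_deriveV Dx0 hD.
  apply: is_derive_eq; rewrite /GRing.scale/=; field.
  by [].
- have Dx : 0 < D x by apply: D0; lra.
  rewrite mulNr oppr_le0 divr_ge0 ?sqr_ge0// /D /dD.
  have := @log_odds_ge x; set l := log_odds x => h.
  have {}h : 2 - 4 * x <= l by apply: h; lra.
  have h1 : 4^-1 <= 2^-1 - x + x ^+ 2 by nra.
  nra.
Qed.

(** For [b < 1/2] the slope [c] is that of the curve [(deficit, energy)] at [b].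
    As slopes decrease along [y], the right-hand side minus the left-hand side
    decreases up to [b] and increases after it. *)
Lemma energy_support b : 0 < b <= 2^-1 ->
  exists2 c, 0 <= c & forall y, 0 < y <= 2^-1 ->
    energy b + c * (deficit y - deficit b) <= energy y.
Proof.
move=> /andP[b0]; rewrite le_eqVlt => /predU1P[->|bh].
  (* At [b = 1/2] both functions vanish, and the slope 0 is enough. *)
  exists 0 => // y yh; rewrite mul0r addr0 /energy subrr mul0r.
  by rewrite mulr_ge0 ?log_odds_ge0//; lra.
pose k := (2^-1 - b) / (b * (1 - b) * log_odds b).
have k0 : 0 <= k.
  by rewrite divr_ge0 ?mulr_ge0 ?log_odds_ge0//; lra.
exists (1 + k); first by lra.
move=> y /andP[y0 yh].
suff : energy b - (1 + k) * deficit b <= energy y - (1 + k) * deficit y by lra.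
have dF x : 0 < x < 1 -> is_derive x 1 (fun x => energy x - (1 + k) * deficit x)
    (k * log_odds x - (2^-1 - x) / (x * (1 - x))).
  move=> x01; have h1 := is_derive_energy x01; have h2 := is_derive_deficit x01.
  by apply: is_derive_eq; rewrite /GRing.scale/=; ring.
have e x : 0 < x < 2^-1 -> (2^-1 - x) / (x * (1 - x)) =
     (2^-1 - x) / (x * (1 - x) * log_odds x) * log_odds x.
  move=> xb; have : log_odds x != 0 by rewrite gt_eqF ?log_odds_gt0.
  by move=> ?; field; lra.
have [yb|by_] := leP y b.
- apply: (@derive_le0_le (fun x => energy x - (1 + k) * deficit x)
    (fun x => k * log_odds x - (2^-1 - x) / (x * (1 - x))) y b yb).
    by move=> x xyb; apply: dF; lra.
  move=> x xyb.
  rewrite e ?subr_le0; last by lra.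
  rewrite ler_wpM2r ?log_odds_ge0//; first by lra.
  by apply: slope_nonincreasing; lra.
- suff: - (energy y - (1 + k) * deficit y) <= - (energy b - (1 + k) * deficit b).
    by lra.
  apply: (@derive_le0_le (fun x => - (energy x - (1 + k) * deficit x))
    (fun x => - (k * log_odds x - (2^-1 - x) / (x * (1 - x)))) b y (ltW by_)).
    move=> x xyb; have : 0 < x < 1 by lra.
    by move=> /dF h; exact: is_deriveN.
  move=> x xyb; rewrite oppr_le0 subr_ge0 e; last by lra.
  rewrite ler_wpM2r ?log_odds_ge0//; first by lra.
  by apply: slope_nonincreasing; lra.
Qed.

Lemma energy_lt a b : 0 < a -> a < b -> b <= 2^-1 -> energy b < energy a.
Proof.
move=> a0 ab bh; rewrite /energy.
apply: (@le_lt_trans _ _ ((2^-1 - a) * log_odds b)).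
  by rewrite ler_wpM2r ?log_odds_ge0//; lra.
by rewrite ltr_pM2l ?log_odds_lt//; lra.
Qed.

Lemma b1_deficit y : 0 < y <= 2^-1 -> b1 (deficit y) = energy y.
Proof.
move=> yh; rewrite /b1 /b1_param.
case: xgetP => [x _ [xh e]|/(_ y)/not_andP[]//].
have -> : x = y by apply: deficit_inj; rewrite ?in_itv/=.
by rewrite /energy log_oddsE//; lra.
Qed.

Lemma b1_support s : 0 <= s < ln 2 ->
  exists2 c, 0 <= c & forall t, 0 <= t < ln 2 -> b1 s + c * (t - s) <= b1 t.
Proof.
move=> /deficit_surj[b hb <-]; have [c c0 h] := energy_support hb.
exists c => // t /deficit_surj[y hy <-]; rewrite !b1_deficit//; exact: h.
Qed.

Lemma b1_ge0 t : 0 <= t < ln 2 -> 0 <= b1 t.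
Proof.
move=> /deficit_surj[y hy <-]; rewrite b1_deficit// /energy.
by rewrite mulr_ge0 ?log_odds_ge0//; lra.
Qed.

Lemma b1_lt : {in `[0, ln 2[ &, {homo @b1 R : s t / s < t}}.
Proof.
move=> s t; rewrite !in_itv/= => /deficit_surj[a ha <-] /deficit_surj[b hb <-].
rewrite !b1_deficit// => h; apply: energy_lt; try lra.
rewrite ltNge; apply/negP => ab; move: h; apply/negP; rewrite -leNgt.
by apply: deficit_le => //; lra.
Qed.

Lemma b1_convex : @convex_function R R^o `[0, ln 2[%classic (@b1 R).
Proof.
move=> l s t; rewrite !inE/= !in_itv/= => hs ht.
have : 0 <= l%:num <= 1 by rewrite ge0 le1.
change (0 <= l%:num <= 1 -> b1 (l%:num * s + (1 - l%:num) * t) <=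
  l%:num * b1 s + (1 - l%:num) * b1 t).
move: (l%:num) => w /andP[w0 w1].
set p := w * s + _.
have hp : 0 <= p < ln 2.
  rewrite /p; apply/andP; split; first by rewrite addr_ge0// mulr_ge0//; lra.
  by rewrite /p; have [st|ts] := leP (s : R) t; nra.
have [c c0 h] := b1_support hp.
have {}hs := h s hs; have {}ht := h t ht.
have : w * (b1 p + c * (s - p)) <= w * b1 s by rewrite ler_wpM2l.
have : (1 - w) * (b1 p + c * (t - p)) <= (1 - w) * b1 t.
  by rewrite ler_wpM2l//; lra.
have : w * (b1 p + c * (s - p)) + (1 - w) * (b1 p + c * (t - p)) = b1 p.
  by rewrite /p; ring.
lra.
Qed.
End one_variable.

(** * One edge of the cube *)

Section two_point.
Context {R : realType}.
Implicit Types a b c s : R.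

(** The entropy of the function with values [a] and [b] on a two-point uniform
    space. *)
Definition pair_entropy a b : R :=
  (a * (ln a - ln ((a + b) / 2)) + b * (ln b - ln ((a + b) / 2))) / 2.

(** The case of equality: up to scaling, functions on one edge are parametrized
    by the fraction [y] of the mass at the smaller value. *)
Lemma pair_param a b : 0 < a -> 0 < b ->
  exists y, [/\ 0 < y <= 2^-1,
    pair_entropy a b = (a + b) / 2 * deficit y &
    (a - b) * (ln a - ln b) / 4 = (a + b) / 2 * energy y].
Proof.
move=> a0 b0; wlog ba : a b a0 b0 / b <= a.
  move=> H; have [ba|/ltW ab] := leP b a; first exact: H.
  have [y [yh e1 e2]] := H b a b0 a0 ab; exists y; split=> //.
  - by rewrite [a + b]addrC -e1 /pair_entropy [a + b]addrC; ring.
  - by rewrite [a + b]addrC -e2; ring.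
have ab0 : 0 < a + b by rewrite addr_gt0.
have yE : 1 - b / (a + b) = a / (a + b) by field; rewrite gt_eqF.
exists (b / (a + b)).
rewrite /pair_entropy /energy /log_odds /deficit /bin_entropy yE.
rewrite !ln_div ?posrE//; split.
- by rewrite divr_gt0//= ler_pdivrMr//; lra.
- by field; rewrite gt_eqF.
- by field; rewrite gt_eqF.
Qed.

Lemma pair_entropy_lt a b : 0 < a -> 0 < b ->
  pair_entropy a b < (a + b) / 2 * ln 2.
Proof.
move=> a0 b0; have [y [yh -> _]] := pair_param a0 b0.
by rewrite ltr_pM2l ?deficit_lt_ln2// divr_gt0// addr_gt0.
Qed.

(** The one-edge inequality, linearized by a supporting line of [b1] so that it
    can be summed over edges of different masses. *)
Lemma pair_b1_support s c a b :
    (forall t, 0 <= t < ln 2 -> b1 s + c * (t - s) <= b1 t) ->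
    0 < a -> 0 < b ->
  (a + b) / 2 * (b1 s - c * s) + c * pair_entropy a b <=
  (a - b) * (ln a - ln b) / 4.
Proof.
move=> h a0 b0; have [y [yh -> ->]] := pair_param a0 b0.
rewrite -(b1_deficit yh) mulrCA -mulrDr ler_pM2l ?divr_gt0 ?addr_gt0//.
have := h (deficit y); rewrite deficit_ge0// deficit_lt_ln2// => /(_ isT).
lra.
Qed.
End two_point.

(** * Averaging over edges and subadditivity of entropy *)

Section cube.
Context {R : realType} {n : nat}.
Implicit Types (f g h : cube n -> R) (x y : cube n) (i j : 'I_n).

Definition flip i x : cube n := [ffun j => (j == i) (+) x j].

Lemma flipK i : involutive (flip i).
Proof. by move=> x; apply/ffunP => j; rewrite !ffunE addbA addbb. Qed.

Lemma flipC i j x : flip i (flip j x) = flip j (flip i x).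
Proof. by apply/ffunP => k; rewrite !ffunE addbCA. Qed.

Lemma flip_inj x : injective (flip^~ x).
Proof.
move=> i j /ffunP/(_ i); rewrite !ffunE eqxx.
by move=> /addIb/esym/eqP.
Qed.

Lemma cube_adjP x y : reflect (exists i, y = flip i x) (cube_adj x y).
Proof.
apply: (iffP idP) => [/eqP/mem_card1[i ei]|[i ->]].
  exists i; apply/ffunP => j; rewrite ffunE.
  by move: (ei j); rewrite !inE => <-; case: (x j) (y j) => -[].
apply/eqP; apply: (@fintype.eq_card1 _ i) => j.
by rewrite !inE/= ffunE; case: (j == i); case: (x j).
Qed.

Lemma big_cube_adj x g : \sum_(y | cube_adj x y) g y = \sum_i g (flip i x).
Proof.
rewrite -(big_imset _ (in2W (@flip_inj x))) /=.
by apply: eq_bigl => y; apply/cube_adjP/imsetP => [[i ->]|[i _ ->]]; exists i.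
Qed.

Lemma card_cube_gt0 : 0 < #|cube n|%:R :> R.
Proof. by rewrite ltr0n; apply/card_gt0P; exists [ffun=> false]. Qed.

Lemma eq_expect f g : f =1 g -> expect f = expect g.
Proof. by move=> fg; rewrite /expect (eq_bigr g). Qed.

Lemma expectD f g : expect (fun x => f x + g x) = expect f + expect g.
Proof. by rewrite /expect big_split/= mulrDl. Qed.

Lemma expectZ a f : expect (fun x => a * f x) = a * expect f.
Proof. by rewrite /expect -mulr_sumr mulrA. Qed.

Lemma expectB f g : expect (fun x => f x - g x) = expect f - expect g.
Proof. by rewrite /expect sumrB mulrBl. Qed.

Lemma expect_cst (a : R) : expect (fun _ : cube n => a) = a.
Proof.
by rewrite /expect sumr_const -[a *+ _]mulr_natr mulfK// gt_eqF// card_cube_gt0.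
Qed.

Lemma expect_sum (F : 'I_n -> cube n -> R) :
  expect (fun x => \sum_i F i x) = \sum_i expect (F i).
Proof. by rewrite /expect exchange_big/= mulr_suml. Qed.

Lemma le_expect f g : (forall x, f x <= g x) -> expect f <= expect g.
Proof.
by move=> fg; rewrite ler_pM2r ?invr_gt0 ?card_cube_gt0// ler_sum.
Qed.

Lemma lt_expect f g : (forall x, f x < g x) -> expect f < expect g.
Proof.
move=> fg; rewrite ltr_pM2r ?invr_gt0 ?card_cube_gt0// ltr_sum//.
by apply/hasP; exists [ffun=> false]; rewrite ?mem_index_enum.
Qed.

Lemma expect_flip i f : expect (fun x => f (flip i x)) = expect f.
Proof. by rewrite /expect [in RHS](reindex_inj (inv_inj (flipK i))). Qed.

Definition avg i f x : R := (f x + f (flip i x)) / 2.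

Lemma expect_avg i f : expect (avg i f) = expect f.
Proof.
rewrite (@eq_expect _ (fun x => 2^-1 * (f x + f (flip i x)))).
  by rewrite expectZ expectD expect_flip; field.
by move=> x; rewrite mulrC.
Qed.

Lemma avg_gt0 i f : (forall x, 0 < f x) -> forall x, 0 < avg i f x.
Proof. by move=> f0 x; rewrite divr_gt0// addr_gt0. Qed.

Lemma avg_flip i f x : avg i f (flip i x) = avg i f x.
Proof. by rewrite /avg flipK addrC. Qed.

(** Averaging along direction [i] is the conditional expectation given the other
    coordinates, so functions of these coordinates factor out. *)
Lemma expect_avgM i f h : (forall x, h (flip i x) = h x) ->
  expect (fun x => avg i f x * h x) = expect (fun x => f x * h x).
Proof.
move=> hi; rewrite -[RHS](expect_avg i); apply: eq_expect => x.
by rewrite /avg hi; ring.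
Qed.

(** The mean, over the edges in direction [i], of the entropy of [f] on the
    edge. *)
Definition edge_entropy i f : R :=
  expect (fun x => f x * (ln (f x) - ln (avg i f x))).

(** Gibbs' inequality on every edge: [g / avg i g] and [f / avg i f] are
    probability densities on the edge, and the best density to predict [f] is its
    own.  The proof is [ln u <= u - 1] for the quotient [u] of the two densities,
    whose [f]-weighted mean is 1 on each edge. *)
Lemma expect_ln_ratio_le i f g : (forall x, 0 < f x) -> (forall x, 0 < g x) ->
  expect (fun x => f x * (ln (g x) - ln (avg i g x))) <= edge_entropy i f.
Proof.
move=> f0 g0; rewrite -subr_le0 -expectB.
pose q x := avg i f x / avg i g x.
have qi x : q (flip i x) = q x by rewrite /q !avg_flip.
suff <- : expect (fun x => g x * q x - f x) = 0.
  apply: le_expect => x; rewrite -mulrBr.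
  have af := avg_gt0 i f0 x; have ag := avg_gt0 i g0 x.
  have q0 : 0 < q x by rewrite divr_gt0.
  have lnq : ln (q x) = ln (avg i f x) - ln (avg i g x) by rewrite ln_div ?posrE.
  have gq : 0 < g x * q x by rewrite mulr_gt0.
  have h : ln (g x) + ln (q x) - ln (f x) <= g x * q x / f x - 1.
    by rewrite -lnM ?posrE// -ln_div ?posrE// ln_le_sub1// divr_gt0.
  rewrite lnq in h.
  have -> : g x * q x - f x = f x * (g x * q x / f x - 1).
    by field; rewrite gt_eqF.
  by rewrite ler_pM2l//; lra.
rewrite expectB -(expect_avgM g qi) -[X in _ - X](expect_avg i).
rewrite -expectB -[RHS]expect_cst; apply: eq_expect => x.
by rewrite /q mulrC divfK ?subrr// gt_eqF// avg_gt0.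
Qed.

Definition avgs (s : seq 'I_n) f : cube n -> R := foldr avg f s.

Lemma avgs_gt0 s f : (forall x, 0 < f x) -> forall x, 0 < avgs s f x.
Proof. by move=> f0; elim: s => //= i s IH; exact: avg_gt0. Qed.

Lemma expect_avgs s f : expect (avgs s f) = expect f.
Proof. by elim: s => //= i s IH; rewrite expect_avg. Qed.

Lemma avgs_flip s f i x : i \in s -> avgs s f (flip i x) = avgs s f x.
Proof.
elim: s x => //= j s IH x; rewrite inE => /predU1P[->|si].
  exact: avg_flip.
by rewrite /avg flipC !IH.
Qed.

(** The cube is connected: induct on the number of coordinates in which the two
    points differ. *)
Lemma flip_invariant_cst f : (forall i x, f (flip i x) = f x) ->
  forall x y, f x = f y.
Proof.
move=> fi x y; move: {2}#|_| (leqnn #|[pred i | x i != y i]|) => k.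
elim: k x => [|k IH] x.
  rewrite leqn0 => /eqP/card0_eq xy; congr f; apply/ffunP => i.
  by move: (xy i); rewrite !inE => /negbFE/eqP.
have [i xyi|xy _] := pickP [pred i | x i != y i]; last first.
  by congr f; apply/ffunP => i; apply/eqP/negbFE/xy.
rewrite (cardD1 i) [_ \in _]xyi add1n ltnS => h.
rewrite -(fi i x); apply: IH; apply: leq_trans h; apply: subset_leq_card.
apply/fintype.subsetP => j; rewrite !inE ffunE; case: (j =P i) => [->|//].
by move: xyi => /=; case: (x i) (y i) => -[].
Qed.

(** The iterated average is invariant under all flips, hence constant, and
    averaging preserves the expectation. *)
Lemma avgs_enum f x : avgs (enum 'I_n) f x = expect f.
Proof.
rewrite -(expect_avgs (enum 'I_n) f) -[LHS]expect_cst.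
apply: eq_expect => y; apply: flip_invariant_cst => i z.
by rewrite avgs_flip// mem_enum.
Qed.

(** The logarithm telescopes along the successive averages, and each averaging
    step is an instance of Gibbs' inequality. *)
Lemma expect_ln_avgs_le s f : (forall x, 0 < f x) ->
  expect (fun x => f x * (ln (f x) - ln (avgs s f x))) <=
  \sum_(i <- s) edge_entropy i f.
Proof.
move=> f0; elim: s => [|i s IH].
  rewrite big_nil -[leRHS]expect_cst; apply: le_expect => x.
  by rewrite /= subrr mulr0.
rewrite big_cons addrC.
apply: le_trans (lerD IH (expect_ln_ratio_le i f0 (avgs_gt0 s f0))).
by rewrite -expectD; apply: le_expect => x /=; rewrite -mulrDr addrA subrK.
Qed.

Lemma Ent_le_sum_edge_entropy f : (forall x, 0 < f x) ->
  Ent f <= \sum_i edge_entropy i f.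
Proof.
move=> f0; have := expect_ln_avgs_le (enum 'I_n) f0.
rewrite big_enum /=; apply: le_trans.
have E0 : 0 < expect f by rewrite -[ltLHS]expect_cst lt_expect.
by apply: le_expect => x; rewrite avgs_enum ln_div ?posrE.
Qed.

Lemma Ent_ge0 f : (forall x, 0 < f x) -> 0 <= Ent f.
Proof.
move=> f0; have E0 : 0 < expect f by rewrite -[ltLHS]expect_cst lt_expect.
have e : expect (fun x => f x - expect f) = 0.
  by rewrite expectB expect_cst subrr.
rewrite -{1}e; apply: le_expect => x.
have h : ln (expect f) - ln (f x) <= expect f / f x - 1.
  by rewrite -ln_div ?posrE// ln_le_sub1// divr_gt0.
rewrite ln_div ?posrE//.
have -> : f x - expect f = f x * (1 - expect f / f x).
  by field; rewrite gt_eqF.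
by rewrite ler_pM2l//; lra.
Qed.

(** Summation by parts: each edge occurs twice in the Dirichlet form, once from
    each endpoint, and averaging the two occurrences gives the symmetric
    form. *)
Lemma dirichlet_flip f g : dirichlet f g =
  \sum_i expect (fun x => (f x - f (flip i x)) * (g x - g (flip i x)) / 4).
Proof.
rewrite /dirichlet -expectZ.
transitivity (\sum_i expect (fun x => 2^-1 * ((f x - f (flip i x)) * g x))).
  rewrite -expect_sum -[LHS]mulN1r -expectZ; apply: eq_expect => x.
  rewrite /laplacian big_cube_adj -mulr_sumr mulN1r -mulrN -mulNr -mulr_suml.
  by rewrite -sumrN; under eq_bigr do rewrite opprB.
apply: eq_bigr => i _; rewrite -(expect_avg i); apply: eq_expect => x.
by rewrite /avg flipK; field.
Qed.

(** Averaging the two endpoints of each edge turns the integrand of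
    [edge_entropy] into the entropy on that edge. *)
Lemma edge_entropy_pair i f : edge_entropy i f =
  expect (fun x => pair_entropy (f x) (f (flip i x))).
Proof.
rewrite /edge_entropy -(expect_avg i); apply: eq_expect => x.
by rewrite {1}/avg avg_flip.
Qed.

End cube.

(** * The inequality on the cube *)

Section main.
Context {R : realType} {n : nat}.
Implicit Types (f : cube n -> R).

Lemma edge_entropy_lt_ln2 i f : (forall x, 0 < f x) ->
  edge_entropy i f < expect f * ln 2.
Proof.
move=> f0; rewrite edge_entropy_pair -(expect_avg i f) mulrC -expectZ.
by apply: lt_expect => x; rewrite [ltRHS]mulrC; apply: pair_entropy_lt.
Qed.

Lemma b1_support_edge i f s c : (forall x, 0 < f x) ->
    (forall t, 0 <= t < ln 2 -> b1 s + c * (t - s) <= b1 t) ->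
  expect f * (b1 s - c * s) + c * edge_entropy i f <=
  expect (fun x => (f x - f (flip i x)) * (ln (f x) - ln (f (flip i x))) / 4).
Proof.
move=> f0 h; rewrite edge_entropy_pair -(expect_avg i f) mulrC -!expectZ -expectD.
by apply: le_expect => x; rewrite [X in X + _]mulrC; apply: pair_b1_support.
Qed.

Lemma Ent_lt f : (0 < n)%N -> (forall x, 0 < f x) -> expect f = 1 ->
  Ent f < n%:R * ln 2.
Proof.
move=> n0 f0 f1; apply: le_lt_trans (Ent_le_sum_edge_entropy f0) _.
have -> : n%:R * ln 2 = \sum_(i < n) (ln 2 : R).
  by rewrite sumr_const card_ord mulr_natl.
apply: ltr_sum; first by apply/hasP; exists (Ordinal n0); rewrite ?mem_index_enum.
by move=> i _; have := edge_entropy_lt_ln2 i f0; rewrite f1 mul1r.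
Qed.

(** Summing the supporting line at [s = Ent f / n] over the directions leaves
    [n * b1 s + c * (\sum_i edge_entropy i f - Ent f)], and the last term is
    nonnegative by subadditivity. *)
Lemma log_sobolev_b1 f : (0 < n)%N -> (forall x, 0 < f x) -> expect f = 1 ->
  b1 (Ent f / n%:R) <= dirichlet f (@ln R \o f) / n%:R.
Proof.
move=> n0 f0 f1; have n0R : 0 < n%:R :> R by rewrite ltr0n.
set s := Ent f / n%:R.
have hs : 0 <= s < ln 2.
  by rewrite divr_ge0 ?Ent_ge0 ?ltW//= ltr_pdivrMr// mulrC Ent_lt.
have [c c0 hc] := b1_support hs.
rewrite ler_pdivlMr// mulrC dirichlet_flip.
have : \sum_i (b1 s - c * s + c * edge_entropy i f) <=
  \sum_i expect (fun x => (f x - f (flip i x)) * (ln (f x) - ln (f (flip i x))) / 4).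
  by apply: ler_sum => i _; have := b1_support_edge i f0 hc; rewrite f1 mul1r.
apply: le_trans; rewrite big_split/= sumr_const card_ord -[_ *+ _]mulr_natl -mulr_sumr.
have : c * Ent f <= c * \sum_i edge_entropy i f.
  by rewrite ler_wpM2l// Ent_le_sum_edge_entropy.
have -> : Ent f = n%:R * s by rewrite /s mulrC divfK// gt_eqF.
lra.
Qed.
End main.

Theorem theorem4 (R : realType) :
  [/\ set_bij `]0, 2^-1] `[0, ln 2[ (fun y : R => ln 2 - bin_entropy y),
      forall y : R, 0 < y <= 2^-1 ->
        b1 (ln 2 - bin_entropy y) = (2^-1 - y) * ln ((1 - y) / y),
      forall t : R, 0 <= t < ln 2 -> 0 <= b1 t,
      {in `[0, ln 2[ &, {homo @b1 R : s t / s < t}} &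
      @convex_function R R^o `[0, ln 2[%classic (@b1 R)] /\
  forall (n : nat) (f : cube n -> R),
    (1 <= n)%N -> (forall x, 0 < f x) -> expect f = 1 ->
    0 <= Ent f / n%:R < ln 2 /\
    b1 (Ent f / n%:R) <= dirichlet f (@ln R \o f) / n%:R.
Proof.
split; [split|].
- split.
  + move=> y /=; rewrite !in_itv/= => hy.
    by rewrite deficit_ge0// deficit_lt_ln2.
  + by move=> a b; rewrite !inE; exact: deficit_inj.
  + by move=> t /=; rewrite in_itv => /deficit_surj[y hy <-]; exists y; rewrite //= in_itv.
- by move=> y hy; rewrite [LHS](b1_deficit hy) /energy log_oddsE//; lra.
- exact: b1_ge0.
- exact: b1_lt.
- exact: b1_convex.
- move=> n f n0 f0 f1; split; last exact: log_sobolev_b1.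
  have n0R : 0 < n%:R :> R by rewrite ltr0n.
  by rewrite divr_ge0 ?Ent_ge0 ?ltW//= ltr_pdivrMr// mulrC Ent_lt.
Qed.
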